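(* Let $\mathscr{A}$ be a unital (complex) $^*$-algebra and let $w$ and $v$ be representable functionals on $\mathscr{A}$. Then $w$ splits into strongly $v$-absolute continuous and $v$-singular parts; that is, there exist representable functionals $w_r$ and $w_s$ on $\mathscr{A}$ such that $w=w_r+w_s$, where $w_r$ is strongly $v$-absolute continuous and $w_s$ is $v$-singular.
   Context: A linear functional $w:\mathscr{A}\to\mathbb{C}$ is positive if $w(a^*a)\ge 0$ for all $a\in\mathscr{A}$. For positive functionals $w,v$ write $w\le v$ if $v-w$ is positive. A linear functional $w$ on $\mathscr{A}$ is called representable if there are a Hilbert space $\mathscr{H}_w$, a $^*$-representation $\pi_w$ of $\mathscr{A}$ in $\mathscr{H}_w$ (a $^*$-homomorphism from $\mathscr{A}$ into the bounded operators on $\mathscr{H}_w$), and a vector $\zeta_w\in\mathscr{H}_w$ such that $w(a)=(\pi_w(a)\zeta_w\,|\,\zeta_w)$ for all $a\in\mathscr{A}$. Every representable functional is positive. Let $w,v$ be representable functionals on $\mathscr{A}$. The functional $w$ is strongly $v$-absolute continuous if for every sequence $(a_n)_{n\in\mathbb{N}}$ in $\mathscr{A}$: whenever $v(a_n^*a_n)\to 0$ as $n\to\infty$ and $w((a_n-a_m)^*(a_n-a_m))\to 0$ as $n,m\to\infty$, then $w(a_n^*a_n)\to 0$ as $n\to\infty$. The functional $w$ is $v$-singular if for every representable functional $u$ on $\mathscr{A}$, the inequalities $u\le w$ and $u\le v$ imply $u=0$. *)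

(* Defs.v *)
From HB Require Import structures.
From mathcomp Require Import all_boot all_order all_algebra.
From mathcomp Require Import complex.
From mathcomp Require Import all_classical all_reals all_analysis.

Set Implicit Arguments.
Unset Strict Implicit.
Unset Printing Implicit Defensive.

Import Order.TTheory GRing.Theory Num.Theory.
Import numFieldNormedType.Exports.

Local Open Scope classical_set_scope.
Local Open Scope ring_scope.

HB.mixin Record isStarAlgebra (C : numClosedFieldType) A
    of GRing.Algebra C A := {
  star : A -> A ;
  starK : involutive star ;
  starD : {morph star : a b / a + b} ;
  starZ : forall (c : C) (a : A), star (c *: a) = c^* *: star a ;
  starM : forall a b : A, star (a * b) = star b * star a
}.

#[short(type="starAlgType")]
HB.structure Definition StarAlgebra (C : numClosedFieldType) :=
  {A of GRing.Algebra C A & isStarAlgebra C A}.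

HB.mixin Record isHilbert (C : numClosedFieldType) H
    of CompleteNormedModule C H := {
  hdot : {dot H for Num.conj} ;
  sqr_norm_hdot : forall x : H, `|x| ^+ 2 = hdot x x
}.

#[short(type="hilbertType")]
HB.structure Definition Hilbert (C : numClosedFieldType) :=
  {H of CompleteNormedModule C H & isHilbert C H}.

Section Functionals.
Context {C : numClosedFieldType}.

Definition bounded_operator (H : hilbertType C) (T : {linear H -> H}) : Prop :=
  exists M : C, forall x : H, `|T x| <= M * `|x|.

(* As a *-homomorphism, [pi] is not required to map [1] to the identity. *)
Definition star_representation (A : starAlgType C) (H : hilbertType C)
    (pi : A -> {linear H -> H}) : Prop :=
  [/\ forall a, bounded_operator (pi a),
      forall (c : C) (a b : A) (x : H),
        pi (c *: a + b) x = c *: pi a x + pi b x,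
      forall (a b : A) (x : H), pi (a * b) x = pi a (pi b x)
    & forall (a : A) (x y : H), hdot (pi (star a) x) y = hdot x (pi a y)].

Definition representable (A : starAlgType C) (w : {scalar A}) : Prop :=
  exists (H : hilbertType C) (pi : A -> {linear H -> H}) (zeta : H),
    star_representation pi /\ forall a : A, w a = hdot (pi a zeta) zeta.

(* In the order of [C], [0 <= z] says that [z] is real and nonnegative. *)
Definition positive_functional (A : starAlgType C) (w : {scalar A}) : Prop :=
  forall a : A, 0 <= w (star a * a).

Definition le_functional (A : starAlgType C) (w v : {scalar A}) : Prop :=
  positive_functional (v \- w).

Definition strongly_abs_continuous (A : starAlgType C) (v w : {scalar A}) :
    Prop :=
  forall a_ : nat -> A,
    v (star (a_ n) * a_ n) @[n --> \oo] --> (0 : C) ->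
    w (star (a_ p.1 - a_ p.2) * (a_ p.1 - a_ p.2)) @[p --> (\oo, \oo)]
      --> (0 : C) ->
    w (star (a_ n) * a_ n) @[n --> \oo] --> (0 : C).

Definition singular_functional (A : starAlgType C) (v w : {scalar A}) : Prop :=
  forall u : {scalar A}, representable u ->
    le_functional u w -> le_functional u v -> u =1 \0.

End Functionals.

(* Main.v *)
(** Let [w] and [v] be given by representations [pi] on [H] and [rho] on [K] with vectors [z] and [t].
    Let [D] be the domain of the adjoint of the relation [rho a t |-> pi a z]: the set of all [y]
    such that [<pi a z, y> = <rho a t, x>] for some [x] and all [a]. Both [D] and [M], the orthogonal
    complement of [D], are invariant under [pi]. Split [z = zr + zs] with [zs] in [M] and [zr]
    orthogonal to [M]; the vector functionals of [zr] and [zs] under [pi] are the two parts.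
    If [rho (a_ n) t] tends to [0] and [pi (a_ n) zr] tends to [eta], then [eta] is orthogonal to
    [D] and to [M], hence is [0]. If [u] is representable, [u <= w_s] and [u <= v], then Riesz gives
    [u a = <pi a zs, y> = <rho a t, x>] with [y] in the closed span of the [pi a zs], so [y] lies in
    [M] and, since [<pi a zs, y> = <pi a z, y>], also in [D]; thus [y = 0]. *)
Require Import Defs.
From HB Require Import structures.
From mathcomp Require Import all_boot all_order all_algebra.
From mathcomp Require Import complex.
From mathcomp Require Import ring.
From mathcomp Require Import all_classical all_reals all_analysis.

Set Implicit Arguments.
Unset Strict Implicit.
Unset Printing Implicit Defensive.

Import Order.TTheory GRing.Theory Num.Theory.
Import numFieldNormedType.Exports.

Local Open Scope classical_set_scope.
Local Open Scope ring_scope.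

(** * Inner products: Cauchy-Schwarz and continuity *)

Section HilbertSpace.
Context {C : numClosedFieldType} {H : hilbertType C}.
Implicit Types (x y z : H) (a : C).

Local Notation "''[' u , v ]" := (hdot u v).

Lemma hdotC x y : '[y, x] = '[x, y]^*.
Proof. by rewrite hermC mul1r. Qed.

Lemma hdotDl x y z : '[x + y, z] = '[x, z] + '[y, z].
Proof. by rewrite linearDl. Qed.

Lemma hdotBl x y z : '[x - y, z] = '[x, z] - '[y, z].
Proof. by rewrite linearBl. Qed.

Lemma hdotZl a x z : '[a *: x, z] = a * '[x, z].
Proof. by rewrite linearZl_LR. Qed.

Lemma hdotDr x y z : '[z, x + y] = '[z, x] + '[z, y].
Proof. by rewrite linearDr. Qed.

Lemma hdotBr x y z : '[z, x - y] = '[z, x] - '[z, y].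
Proof. by rewrite linearBr. Qed.

Lemma hdotZr a x z : '[z, a *: x] = a^* * '[z, x].
Proof. by rewrite linearZr_LR. Qed.

Lemma hdot_eq0 x : '[x, x] = 0 -> x = 0.
Proof. by move/eqP; rewrite dnorm_eq0 => /eqP. Qed.

Lemma CauchySchwarz_hdot x y : `|'[x, y]| <= `|x| * `|y|.
Proof.
have [->|y0] := eqVneq y 0; first by rewrite linear0r !normr0 mulr0.
have yy : 0 < '[y, y] by rewrite dnorm_gt0.
pose u := x - ('[x, y] / '[y, y]) *: y.
have uy : '[u, y] = 0 by rewrite hdotBl hdotZl divfK ?subrr// gt_eqF.
have xE : x = u + ('[x, y] / '[y, y]) *: y by rewrite subrK.
rewrite -(@ler_pXn2r _ 2)// ?nnegrE// ?mulr_ge0// exprMn !sqr_norm_hdot.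
rewrite {2 3}xE hnormDd/=; last by rewrite hdotZr uy mulr0.
rewrite mulrDl dnormZ normf_div expr_div_n (gtr0_norm yy).
rewrite [X in _ <= _ + X](_ : _ = `|'[x, y]| ^+ 2).
  by rewrite lerDr mulr_ge0// dnorm_ge0.
by rewrite -mulrA -expr2 divfK// expf_neq0// gt_eqF.
Qed.

Lemma cvg_hdotl (T : Type) (F : set_system T) {FF : Filter F} (f : T -> H) x y :
  f t @[t --> F] --> x -> '[f t, y] @[t --> F] --> '[x, y].
Proof.
move=> /cvgrPdist_lt fx; apply/cvgrPdist_lt => e e0.
have y1 : 0 < `|y| + 1 by rewrite ltr_wpDl.
have := fx _ (divr_gt0 e0 y1); apply: filterS => t.
rewrite ltr_pdivlMr// => ft; rewrite -hdotBl.
apply: le_lt_trans (CauchySchwarz_hdot _ _) (le_lt_trans _ ft).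
by rewrite ler_wpM2l// lerDl.
Qed.

End HilbertSpace.

(** Converts limits of scalars that dominate squared norms, such as values [w (star a * a)], into
    limits of vectors. *)
Lemma cvg0_sqr_le (C : numFieldType) (V : pseudoMetricNormedZmodType C) (T : Type)
    (F : set_system T) {FF : Filter F} (f : T -> V) (e : T -> C) (K : C) :
  0 <= K -> (forall t, `|f t| ^+ 2 <= K * e t) ->
  e t @[t --> F] --> (0 : C) -> f t @[t --> F] --> (0 : V).
Proof.
move=> K0 fe /cvgr0Pnorm_lt e0; apply/cvgr0Pnorm_lt => d d0.
(* [K] may vanish, so the threshold divides by [K + 1]. *)
have K1 : 0 < K + 1 by rewrite ltr_wpDl.
have := e0 _ (divr_gt0 (exprn_gt0 2 d0) K1); apply: filterS => t.
rewrite ltr_pdivlMr// => et.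
rewrite -(@ltr_pXn2r _ 2)// ?nnegrE// ?ltW//.
apply: le_lt_trans et; apply: (le_trans (fe t)).
(* [e t] is not assumed real, but a number above a nonnegative one is real in this order. *)
have Ke : K * e t \is Num.real.
  by rewrite ger0_real// (le_trans _ (fe t))// exprn_ge0.
apply: (le_trans (real_ler_norm Ke)).
by rewrite normrM (ger0_norm K0) mulrC ler_wpM2l// lerDl.
Qed.

Lemma cvg_seq_cauchy (C : numFieldType) (V : completeNormedModType C)
    (u : nat -> V) :
  (u p.1 - u p.2) @[p --> (\oo, \oo)] --> (0 : V) ->
  cvg (u n @[n --> \oo]).
Proof.
move=> /cvgr0Pnorm_lt uu; apply: cauchy_cvg; apply/cauchy_ballP => e e0.
case: (uu _ e0) => -[/= A B] [oA oB] AB; exists (u @` A, u @` B).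
  by split => /=; [apply: filterS oA|apply: filterS oB] => n; exists n.
move=> [_ _] [/= [m Am <-] [n Bn <-]].
by have := AB (m, n) (conj Am Bn); rewrite -ball_normE.
Qed.

(** * Riesz representation over [R[i]] *)

Section Riesz.
Context {R : realType}.

(** Comparable elements of [R[i]] share their imaginary part, so the lower bound [b] forces [P] onto
    one horizontal line, where the infimum of the real parts does the job. *)
Lemma complex_inf_adherent (P : set R[i]) (b : R[i]) :
  P !=set0 -> (forall z, P z -> b <= z) ->
  exists m, (forall z, P z -> m <= z) /\
    forall e, 0 < e -> exists2 z, P z & z < m + e.
Proof.
move=> [z0 Pz0] bP; pose E := [set complex.Re z | z in P].
have PIm z : P z -> complex.Im z = complex.Im b.
  by move=> /bP; rewrite lecE => /andP[/eqP].
have infE : has_inf E.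
  split; first by exists (complex.Re z0), z0.
  by exists (complex.Re b) => _ [z Pz <-]; have := bP _ Pz; rewrite lecE => /andP[].
exists (Complex (inf E) (complex.Im b)); split=> [z Pz|e].
  rewrite lecE/= PIm// eqxx/=; apply: ge_inf; first exact: infE.2.
  by exists z.
rewrite ltcE => /andP[/eqP Ime Ree].
have [_ [z Pz <-] zm] := inf_adherent Ree infE.
exists z => //; case: e => er ei /= in Ime Ree zm *.
by rewrite ltcE/= Ime addr0 PIm// eqxx.
Qed.

Lemma cvg_complex_harmonic (C : numClosedFieldType := R[i]) :
  n.+1%:R^-1 @[n --> \oo] --> (0 : C).
Proof.
apply/cvgr0Pnorm_lt => e; rewrite ltcE => /andP[/eqP Ime Ree].
have := near_infty_natSinv_lt (PosNum Ree); apply: filterS => n /= ne.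
rewrite ger0_norm ?invr_ge0//.
have -> : n.+1%:R^-1 = (n.+1%:R^-1 : R)%:C%C by rewrite fmorphV/= rmorph_nat.
by rewrite ltcE/= ne Ime eqxx.
Qed.

Variables (H : hilbertType R[i]).
Local Notation "''[' u , v ]" := (hdot u v).

(* [G] is the graph of a bounded linear functional on a subspace that need not be closed;
   minimizing [phi x c = |x|^2 - 2 Re c] over it avoids passing to the closure. *)
Lemma riesz_graph (G : H -> R[i] -> Prop) (K : R[i]) :
  0 <= K -> G 0 0 ->
  (forall a x y c d, G x c -> G y d -> G (a *: x + y) (a * c + d)) ->
  (forall x c, G x c -> `|c| <= K * `|x|) ->
  exists y : H, (forall x c, G x c -> c = '[x, y]) /\
    forall h, (forall x c, G x c -> '[x, h] = 0) -> '[y, h] = 0.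
Proof.
move=> K0 G0 Glin Gbnd.
pose phi (x : H) (c : R[i]) : R[i] := '[x, x] - (c + c^*).
have [m [mle madh]] : exists m, (forall x c, G x c -> m <= phi x c) /\
    forall e, 0 < e -> exists2 p, G p.1 p.2 & phi p.1 p.2 < m + e.
  (* The lower bound comes from [phi x c >= |x|^2 - 2 K |x| = (|x| - K)^2 - K^2]. *)
  have [||m [mle madh]] :=
      @complex_inf_adherent [set phi p.1 p.2 | p in [set p | G p.1 p.2]] (- K ^+ 2).
  - by exists (phi 0 0), (0, 0).
  - move=> _ [[x c] /= Gxc <-].
    have cr : c + c^* \is Num.real by apply/CrealP; rewrite rmorphD/= conjCK addrC.
    have cle : c + c^* <= K * `|x| *+ 2.
      apply: (le_trans (real_ler_norm cr)); apply: (le_trans (ler_normD _ _)).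
      by rewrite norm_conjC -mulr2n lerMn2r (Gbnd _ _ Gxc) orbT.
    rewrite /phi -sqr_norm_hdot -subr_ge0 opprK.
    apply: (@le_trans _ _ ((`|x| - K) ^+ 2)).
      by rewrite real_exprn_even_ge0// realB ?normr_real ?ger0_real.
    by rewrite sqrrB (mulrC `|x|) lerD2r lerD2l lerN2.
  exists m; split=> [x c Gxc|e e0]; first by apply: mle; exists (x, c).
  by have [_ [p Gp <-] pm] := madh _ e0; exists p.
have GB x y c d : G x c -> G y d -> G (x + y) (c + d).
  by move=> /Glin/[apply]/(_ 1); rewrite scale1r mul1r.
have GZ a x c : G x c -> G (a *: x) (a * c).
  by move=> Gxc; have := Glin a _ _ _ _ Gxc G0; rewrite !addr0.
(* The midpoint of two points of [G] is in [G], so [phi] is at least [m] there; the parallelogram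
   identity then makes minimizing sequences Cauchy. *)
have parallelogram x y c d : G x c -> G y d ->
    `|x - y| ^+ 2 <= 2 * ((phi x c - m) + (phi y d - m)).
  move=> Gx Gy; have := mle _ _ (GZ 2^-1 _ _ (GB _ _ _ _ Gx Gy)).
  rewrite -subr_ge0 => mid; rewrite -subr_ge0.
  rewrite [X in 0 <= X](_ : _ = 4 * (phi (2^-1 *: (x + y)) (2^-1 * (c + d)) - m)).
    by rewrite mulr_ge0.
  rewrite /phi sqr_norm_hdot hdotZl hdotZr dnormB dnormD rmorphM rmorphD/=.
  have -> : (2^-1 : R[i])^* = 2^-1 by rewrite fmorphV rmorph_nat.
  by field.
(* Quantitative first-order condition: moving [x] by [- s * g^*] times [k] lowers [phi] by
   [s |g|^2 (1 + s)], which cannot exceed [phi x c - m]. *)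
have gap x c k d : G x c -> G k d ->
    `|'[k, x] - d| ^+ 2 <= ('[k, k] + 1) * (phi x c - m).
  move=> Gx Gk; set g := _ - d; pose s := ('[k, k] + 1)^-1.
  have := mle _ _ (Glin (- (s * g^*)) _ _ _ _ Gk Gx).
  have kk1 : 0 < '[k, k] + 1 by rewrite ltr_wpDl// dnorm_ge0.
  have s0 : 0 < s by rewrite invr_gt0.
  have sr : s^* = s by apply/CrealP; rewrite gtr0_real.
  have skk : s * '[k, k] = 1 - s.
    by rewrite -[X in X - _](mulVf (lt0r_neq0 kk1)) -/s; ring.
  rewrite -subr_ge0 [X in 0 <= X -> _](_ : _ = (phi x c - m) - s * `|g| ^+ 2 * (1 + s)).
    move=> h; rewrite -ler_pdivrMl// -/s; apply: le_trans (_ : s * `|g| ^+ 2 * (1 + s) <= _).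
      by rewrite ler_peMr ?lerDl ?(ltW s0)// mulr_ge0 ?exprn_ge0// ltW.
    by rewrite -subr_ge0.
  rewrite /phi dnormD dnormZ hdotZl normrN normrM exprMn norm_conjC (gtr0_norm s0) normCK.
  have ss q : s ^+ 2 * q * '[k, k] = s * q * (1 - s) by rewrite -skk; ring.
  rewrite ss /g !(rmorphD, rmorphB, rmorphN, rmorphM)/= !conjCK sr; ring.
have [u Gu um] : exists2 u : nat -> H * R[i], forall n, G (u n).1 (u n).2 &
    forall n, phi (u n).1 (u n).2 - m <= n.+1%:R^-1.
  have /choice[u uP] : forall n, exists p, G p.1 p.2 /\ phi p.1 p.2 - m <= n.+1%:R^-1.
    move=> n; have [|p Gp pm] := madh n.+1%:R^-1; first by rewrite invr_gt0.
    by exists p; split => //; rewrite lerBlDl ltW.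
  by exists u => n; have [] := uP n.
have uc : cvg ((u n).1 @[n --> \oo]).
  apply: cvg_seq_cauchy.
  apply: (@cvg0_sqr_le _ _ _ _ _ _ (fun p => p.1.+1%:R^-1 + p.2.+1%:R^-1) 2) => //.
    move=> p; apply: le_trans (parallelogram _ _ _ _ (Gu _) (Gu _)) _.
    by rewrite ler_wpM2l// lerD.
  rewrite -[0]addr0; apply: cvgD.
  - apply: (cvg_comp fst (fun n : nat => n.+1%:R^-1)); first exact: cvg_fst.
    exact: cvg_complex_harmonic.
  - apply: (cvg_comp snd (fun n : nat => n.+1%:R^-1)); first exact: cvg_snd.
    exact: cvg_complex_harmonic.
pose y := lim ((u n).1 @[n --> \oo]).
exists y; split=> [k d Gk|h hG].
  (* Along the minimizing sequence [gap] tends to [0]. The conjugate [d^*] appears because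
     [cvg_hdotl] passes to the limit in the left argument. *)
  have uk : '[(u n).1, k] - d^* @[n --> \oo] --> ('[y, k] - d^*).
    by apply: cvgB; [exact: cvg_hdotl|exact: cvg_cst].
  have uk0 : '[(u n).1, k] - d^* @[n --> \oo] --> (0 : Num.ClosedField.sort R[i]).
    apply: (@cvg0_sqr_le _ _ _ _ _ _ _ ('[k, k] + 1) _ _ cvg_complex_harmonic).
      by rewrite addr_ge0// dnorm_ge0.
    move=> n; rewrite hdotC -rmorphB norm_conjC.
    apply: le_trans (gap _ _ _ _ (Gu n) Gk) _.
    by rewrite ler_wpM2l// addr_ge0// dnorm_ge0.
  by rewrite hdotC (subr0_eq (norm_cvg_unique uk uk0)) conjCK.
have uh : '[(u n).1, h] @[n --> \oo] --> '[y, h] by exact: cvg_hdotl.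
apply: (norm_cvg_unique uh); apply/cvg_ballP => e e0; apply: nearW => n.
by rewrite /= (hG _ _ (Gu n)); exact: ballxx.
Qed.

End Riesz.

(** * Vector functionals of representations and functionals they dominate *)

Section StarRepresentation.
Context {C : numClosedFieldType} {A : starAlgType C} {H : hilbertType C}.
Variable pi : A -> {linear H -> H}.
Hypothesis pi_rep : star_representation pi.
Implicit Types (a b : A) (x y : H) (w u : {scalar A}).

Local Notation "''[' u , v ]" := (hdot u v).

Lemma star_representationB a b x : pi (a - b) x = pi a x - pi b x.
Proof.
by case: pi_rep => _ piD _ _; rewrite addrC -scaleN1r piD scaleN1r addrC.
Qed.

Lemma star_representation_adj a x y : '[pi a x, y] = '[x, pi (star a) y].
Proof. by case: pi_rep => _ _ _ pi_star; rewrite -{1}[a]starK pi_star. Qed.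

Lemma vector_functional_exists x :
  exists w, forall a, w a = '[pi a x, x].
Proof.
case: pi_rep => _ piD _ _.
pose f a := '[pi a x, x].
have lin_f : scalar f by move=> c a b; rewrite /f piD hdotDl hdotZl.
pose ff := GRing.isLinear.Build C A C *%R f lin_f.
by exists (HB.pack_for {scalar A} f ff).
Qed.

Lemma vector_functional_sqr w x : (forall a, w a = '[pi a x, x]) ->
  forall a, w (star a * a) = '[pi a x, pi a x].
Proof. by case: pi_rep => _ _ piM pi_star wE a; rewrite wE piM pi_star. Qed.

End StarRepresentation.

Section DominatedFunctional.
Context {R : realType} {A : starAlgType R[i]} {H : hilbertType R[i]}.
Variable pi : A -> {linear H -> H}.
Hypothesis pi_rep : star_representation pi.
Implicit Types (a b : A) (w u : {scalar A}).

Local Notation "''[' u , v ]" := (hdot u v).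

(** Domination on [star a * a] gives [|rho a z| <= |pi a x|], so by Cauchy-Schwarz [u a] is a
    bounded function of [pi a x]. The last clause places [y] in the closed span of the [pi a x]. *)
Lemma riesz_le_functional u w (x : H) :
  representable u -> (forall a, w a = '[pi a x, x]) -> le_functional u w ->
  exists y : H, (forall a, u a = '[pi a x, y]) /\
    forall h, (forall a, '[pi a x, h] = 0) -> '[y, h] = 0.
Proof.
move=> [H' [rho [z [rho_rep uE]]]] wE le_uw.
have rho_le a : `|rho a z| <= `|pi a x|.
  rewrite -(@ler_pXn2r _ 2)// ?nnegrE// !sqr_norm_hdot.
  have := le_uw a; rewrite /= (vector_functional_sqr pi_rep wE).
  by rewrite (vector_functional_sqr rho_rep uE) subr_ge0.
have [|t a1 a2 c1 c2 [a [-> ->]] [b [-> ->]]|y c [a [-> ->]]|y [yE yh]] :=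
    @riesz_graph R H (fun y c => exists a, y = pi a x /\ c = u a) `|z| (normr_ge0 _).
- exists 0; rewrite linear0.
  by have := star_representationB pi_rep 0 0 x; rewrite !subrr => ->.
- case: pi_rep => _ piD _ _.
  by exists (t *: a + b); rewrite piD linearP.
- rewrite uE; apply: le_trans (CauchySchwarz_hdot _ _) _.
  by rewrite mulrC ler_wpM2l.
exists y; split=> [a|h hx]; first by apply: yE; exists a.
by apply: yh => _ _ [a [-> _]].
Qed.

End DominatedFunctional.

(** * The decomposition of [w] with respect to [v] *)

Theorem theorem4p1 (R : realType) (A : starAlgType R[i]) (w v : {scalar A})
    (w_repr : representable w) (v_repr : representable v) :
  exists w_r w_s : {scalar A},
    [/\ representable w_r, representable w_s, w =1 w_r \+ w_s,
        strongly_abs_continuous v w_r & singular_functional v w_s].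
Proof.
case: w_repr => H [pi [z [pi_rep wE]]].
case: v_repr => K [rho [t [rho_rep vE]]].
pose D (y : H) := exists x : K, forall a, hdot (pi a z) y = hdot (rho a t) x.
pose M (h : H) := forall d, D d -> hdot d h = 0.
have D0 : D 0 by exists 0 => a; rewrite !linear0r.
have Dlin c d1 d2 : D d1 -> D d2 -> D (c *: d1 + d2).
  move=> [x1 d1x] [x2 d2x]; exists (c *: x1 + x2) => a.
  by rewrite !hdotDr !hdotZr d1x d2x.
(* If [x] witnesses [d], then [rho b x] witnesses [pi b d]: move [b] to the left as [star b], apply
   the relation at [star b * a], and move it back. *)
have Dpi b d : D d -> D (pi b d).
  case: (pi_rep) (rho_rep) => _ _ piM pi_star [_ _ rhoM rho_star].
  move=> [x dx]; exists (rho b x) => a.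
  by rewrite -pi_star -piM dx rhoM rho_star.
have Mpi b h : M h -> M (pi b h).
  case: (pi_rep) => _ _ _ pi_star.
  by move=> Mh d Dd; rewrite -pi_star Mh//; exact: Dpi.
(* The Riesz vector of [d |-> hdot d z] on [D] is [zr], the projection of [z] onto the closure of
   [D]. *)
have [|c x y _ _ [Dx ->] [Dy ->]|x _ [Dx ->]|zr [zrE zrM]] :=
  @riesz_graph R H (fun d c => D d /\ c = hdot d z) `|z| (normr_ge0 _).
- by rewrite linear0l.
- by rewrite hdotDl hdotZl; split=> //; exact: Dlin.
- by rewrite mulrC CauchySchwarz_hdot.
have {}zrE d : D d -> hdot d z = hdot d zr by move=> Dd; exact: zrE.
have {}zrM h : M h -> hdot zr h = 0.
  by move=> Mh; apply: zrM => d _ [Dd _]; exact: Mh.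
pose zs := z - zr.
have Mzs : M zs by move=> d Dd; rewrite hdotBr zrE// subrr.
have pizrM a h : M h -> hdot (pi a zr) h = 0.
  by move=> Mh; rewrite (star_representation_adj pi_rep) zrM//; exact: Mpi.
have zE : z = zr + zs by rewrite addrC subrK.
clearbody zs.
have piz a h : M h -> hdot (pi a z) h = hdot (pi a zs) h.
  by move=> Mh; rewrite zE (linearD (pi _)) hdotDl pizrM// add0r.
have [w_r wrE] := vector_functional_exists pi_rep zr.
have [w_s wsE] := vector_functional_exists pi_rep zs.
exists w_r, w_s; split.
- by exists H, pi, zr.
- by exists H, pi, zs.
(* The cross terms vanish because [pi] preserves [M] and [zr] is orthogonal to it. *)
- move=> a; rewrite /= wE wrE wsE zE (linearD (pi _)) hdotDl !hdotDr.
  rewrite (pizrM a zs)// (hdotC zr (pi a zs)) zrM; last exact: Mpi.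
  by rewrite conjC0 addr0 add0r.
- move=> a_ va wa.
  have rt0 : rho (a_ n) t @[n --> \oo] --> (0 : K).
    apply: (@cvg0_sqr_le _ _ _ _ _ _ _ 1 _ _ va) => // n.
    by rewrite mul1r sqr_norm_hdot (vector_functional_sqr rho_rep vE).
  have : cvg (pi (a_ n) zr @[n --> \oo]).
    apply: cvg_seq_cauchy; apply: (@cvg0_sqr_le _ _ _ _ _ _ _ 1 _ _ wa) => // p.
    rewrite mul1r sqr_norm_hdot (vector_functional_sqr pi_rep wrE).
    by rewrite (star_representationB pi_rep).
  set eta := lim _; move=> eta_lim.
  have Meta : M eta.
    move=> d Dd; have [x dx] := Dd.
    (* [pi (a_ n) zs] lies in [M], so [d] does not distinguish [zr] from [z]. *)
    have pid n : hdot (pi (a_ n) zr) d = hdot (rho (a_ n) t) x.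
      rewrite -dx zE (linearD (pi _)) hdotDl [X in _ + X]hdotC.
      by rewrite (Mpi (a_ n) zs Mzs d Dd) conjC0 addr0.
    have etad : hdot (pi (a_ n) zr) d @[n --> \oo] --> hdot eta d.
      exact: cvg_hdotl.
    have : hdot (rho (a_ n) t) x @[n --> \oo] --> hdot 0 x by exact: cvg_hdotl.
    rewrite linear0l; under [X in X @ _]funext do rewrite -pid.
    by move=> /(norm_cvg_unique etad) etad0; rewrite hdotC etad0 conjC0.
  have eta0 : eta = 0.
    have etaeta : hdot (pi (a_ n) zr) eta @[n --> \oo] --> hdot eta eta.
      exact: cvg_hdotl.
    (* As [eta] is itself in [M], every [pi (a_ n) zr] is orthogonal to it. *)
    apply/hdot_eq0/(norm_cvg_unique etaeta).
    under [X in X @ _]funext do rewrite (pizrM _ _ Meta).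
    exact: cvg_cst.
  under [X in X @ _]funext do
    rewrite (vector_functional_sqr pi_rep wrE) -sqr_norm_hdot expr2.
  suff : `|pi (a_ n) zr| * `|pi (a_ n) zr| @[n --> \oo] --> `|eta| * `|eta|.
    by rewrite eta0 normr0 mulr0.
  by apply: cvgM; exact: cvg_norm.
- move=> u u_repr u_ws u_v a.
  have [y [uy yh]] := riesz_le_functional pi_rep u_repr wsE u_ws.
  have [x [ux _]] := riesz_le_functional rho_rep u_repr vE u_v.
  have My : M y.
    (* Each [d] in [D] is orthogonal to all [pi b zs], hence to [y] in their closed span. *)
    move=> d Dd; rewrite hdotC yh ?conjC0// => b.
    by rewrite hdotC (Mpi b zs Mzs d Dd) conjC0.
  have Dy : D y by exists x => b; rewrite piz// -uy ux.
  by rewrite uy (hdot_eq0 (My y Dy)) linear0r.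
Qed.
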